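(* Let $n\ge 20$ with $n\equiv 0\pmod 5$. Then there exists a $5$-uniform hypergraph $\mathcal{H}=(V,\mathcal{E})$ with $EI(\mathcal{H})=C_n$ and $|\mathcal{E}|=\frac{3}{5}n$.
   Context: Hypergraphs $\mathcal{H}=(V,\mathcal{E})$ have no multiple hyperedges; isolated vertices are allowed. $\mathcal{H}$ is $5$-uniform if every hyperedge has exactly $5$ elements. The edge intersection hypergraph of $\mathcal{H}$ is $EI(\mathcal{H})=(V,\mathcal{E}^{EI})$ with $\mathcal{E}^{EI}=\{e_1\cap e_2: e_1,e_2\in\mathcal{E},\ e_1\ne e_2,\ |e_1\cap e_2|\ge 2\}$. $C_n$ is the cycle with vertex set $\{1,\dots,n\}$ and edges $\{i,i+1\}$, $i=1,\dots,n$ (indices mod $n$); ''$EI(\mathcal{H})=C_n$'' means $V=\{1,\dots,n\}$ and $\mathcal{E}^{EI}$ is exactly the edge set of $C_n$. *)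

(* Defs.v *)
From mathcomp Require Export all_boot.

Set Implicit Arguments.
Unset Strict Implicit.
Unset Printing Implicit Defensive.

(* The vertex set is the whole type V, so isolated vertices are allowed; the
   hyperedges form a set, so there are no multiple hyperedges. An equality in
   hypergraph V is an equality of hypergraphs on the same vertex set V. *)
Definition hypergraph (V : finType) := {set {set V}}.

Definition uniform (V : finType) (k : nat) (H : hypergraph V) : Prop :=
  forall e : {set V}, e \in H -> #|e| = k.

Definition EI (V : finType) (H : hypergraph V) : hypergraph V :=
  [set e1 :&: e2 | e1 in H, e2 in H & (e1 != e2) && (2 <= #|e1 :&: e2|)].

(* The ordinal i : 'I_n stands for the vertex i + 1 of {1, ..., n}, and
   ordS i is the successor of i modulo n. *)
Definition cycle_graph (n : nat) : hypergraph 'I_n :=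
  [set [set i; ordS i] | i : 'I_n].

(* Main.v *)
Require Import Defs.
From mathcomp Require Import all_boot.
From mathcomp Require Import zify.

(** Write n = 5k and let a vertex v have block v %/ 5 and residue v %% 5. For
    k >= 5 take, for each j modulo k, three hyperedges that meet every residue
    class exactly once: the blocks of their residues 0, 1, 2, 3, 4 are
      j, j, j, j, j;   j+1, j+2, j+2, j, j;   j+1, j+1, j+3, j+3, j.
    Two hyperedges meet in the residues where the two rows of offsets differ by
    the (constant) difference of the two values of j. So the residues of an
    intersection form a level set of the difference of two rows; these are
      {3,4}, {0}, {1,2};   {4}, {0,1}, {2,3};   {0,4}, {1}, {2}, {3},
    where 0 follows 4 in the next block. The values 0, -1, 1, 3 of the last
    difference are distinct modulo k only if k <> 4. The case n = 20 uses an explicit hypergraph. *)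

Lemma val_ordS n (i : 'I_n) : ordS i = (if i.+1 == n then 0 else i.+1) :> nat.
Proof.
rewrite /=; case: eqP => [->|ne]; first by rewrite modnn.
by rewrite modn_small // ltn_neqAle ltn_ord andbT; apply/eqP.
Qed.

(** By [adj], distinct members share at most the two ends of one cycle edge, and [cov] makes every
    cycle edge occur. *)
Lemma hypergraph_of_family n k (I : finType) (h : I -> {set 'I_n}) :
  3 < n -> 2 < k -> (forall x, #|h x| = k) ->
  (forall x y u v, x != y -> u != v -> u \in h x :&: h y ->
     v \in h x :&: h y -> (v == ordS u) || (u == ordS v)) ->
  (forall v, exists x y, x != y /\ [set v; ordS v] \subset h x :&: h y) ->
  exists H : hypergraph 'I_n,
    [/\ uniform k H, EI H = cycle_graph n & #|H| = #|I|].
Proof.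
move=> n_gt3 k_gt2 card_h adj cov.
have meet x y : x != y -> 1 < #|h x :&: h y| ->
    exists u, h x :&: h y = [set u; ordS u].
  move=> xy /card_gt1P[u [v [hu hv uv]]].
  wlog /eqP vu : u v hu hv uv / v == ordS u => [wl|].
    case/orP: (adj _ _ _ _ xy uv hu hv) => E; first exact: wl E.
    by apply: (wl v u); rewrite // eq_sym.
  exists u; apply/eqP; rewrite eqEsubset subUset !sub1set -vu hu hv !andbT.
  apply/subsetP=> w hw; rewrite !inE; apply/negPn/negP.
  rewrite negb_or => /andP[wu wv].
  (* The cycle has no triangle, because n > 3. *)
  have := adj _ _ _ _ xy wu hw hu; have := adj _ _ _ _ xy wv hw hv.
  move: wu wv uv; rewrite vu -!(inj_eq (@ord_inj n)) !val_ordS.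
  have := ltn_ord u; have := ltn_ord w.
  case: (u.+1 =P n) => ?; case: (w.+1 =P n) => ?;
    by case: (_.+1 =P n); lia.
(* If [h x = h y] with [x != y], the intersection would have [k > 2] elements, but it is a single
   edge. *)
have h_inj : injective h.
  move=> x y Exy; apply/eqP/negPn/negP=> xy.
  have [|u Eu] := meet x y xy; first by rewrite Exy setIid card_h; lia.
  move: k_gt2; rewrite -(card_h x) -[h x]setIid {2}Exy Eu cards2.
  by case: (_ != _).
exists (h @: [set: I]); split; last by rewrite card_imset // cardsT.
  by move=> _ /imsetP[x _ ->].
apply/setP=> e; apply/imset2P/imsetP.
  case=> _ b /imsetP[x _ ->]; rewrite inE => /and3P[/imsetP[y _ {b}->]] hxy gt1 ->.
  have xy : x != y by apply: contraNneq hxy => ->.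
  by have [u ->] := meet x y xy gt1; exists u.
case=> v _ ->; have [x [y [xy sub]]] := cov v.
have card_v : #|[set v; ordS v]| = 2.
  rewrite cards2 -(inj_eq (@ord_inj n)) val_ordS; have := ltn_ord v.
  by case: (v.+1 =P n) => ?; case: eqP => /=; lia.
have gt1 : 1 < #|h x :&: h y| by rewrite -card_v subset_leq_card.
exists (h x) (h y); rewrite ?inE ?imset_f ?(inj_eq h_inj) ?xy //.
(* The intersection contains the edge and has at most two elements, hence equals it. *)
apply/eqP; rewrite eqEcard sub card_v.
by have [u ->] := meet x y xy gt1; rewrite cards2; case: (_ != _).
Qed.

Definition offset (t : 'I_3) (r : nat) : nat :=
  nth 0 (nth [::] [:: [:: 0; 0; 0; 0; 0]; [:: 1; 2; 2; 0; 0];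
                      [:: 1; 1; 3; 3; 0]] t) r.

Definition block_edge {k} (x : 'I_3 * 'I_k) : {set 'I_(5 * k)} :=
  [set v : 'I_(5 * k) | v %/ 5 == (x.2 + offset x.1 (v %% 5)) %% k].

(** Each residue contributes exactly one vertex, so ['I_5] parametrizes the hyperedge. *)
Lemma card_block_edge k (x : 'I_3 * 'I_k) : #|block_edge x| = 5.
Proof.
case: x => t j; have k_gt0 : 0 < k by case: j => j; lia.
have lt_f (r : 'I_5) : 5 * ((j + offset t r) %% k) + r < 5 * k.
  have := ltn_pmod (j + offset t r) k_gt0; have := ltn_ord r; lia.
pose f r := Ordinal (lt_f r).
have f_inj : injective f.
  move=> r s /(congr1 val) /= E; apply: ord_inj => /=.
  have := ltn_ord r; have := ltn_ord s; lia.
transitivity #|f @: [set: 'I_5]|; last by rewrite card_imset // cardsT card_ord.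
apply: eq_card => v; rewrite inE /=; apply/eqP/imsetP => [E|[r _ ->]].
  have r_lt : v %% 5 < 5 by rewrite ltn_mod.
  exists (Ordinal r_lt); rewrite ?inE //; apply: ord_inj => /=.
  by rewrite -E; lia.
rewrite /= mulnC divnMDl // modnMDl (modn_small (ltn_ord r)).
by rewrite divn_small ?addn0.
Qed.

Lemma offset_lt t r : offset t r < 4.
Proof.
rewrite /offset.
by case: t => -[|[|[|//]]] ? /=; case: r => [|[|[|[|[|r]]]]]; rewrite //= nth_nil.
Qed.

(** Trades reduction modulo [k] for linear equations, which [lia] can handle. *)
Lemma modn_once k m p : p < k -> m < k + k ->
  (p == m %% k) = (p == m) || (p + k == m).
Proof.
move=> p_lt m_lt; have [lt_mk|le_km] := ltnP m k.
  by rewrite modn_small //; lia.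
by rewrite -(subnK le_km) modnDr modn_small; lia.
Qed.

Lemma block_edgeE k (t : 'I_3) (j : 'I_k) (v : 'I_(5 * k)) : 4 < k ->
  (v \in block_edge (t, j)) =
  (v %/ 5 == j + offset t (v %% 5)) || (v %/ 5 + k == j + offset t (v %% 5)).
Proof.
move=> k_gt4; rewrite inE /= modn_once //.
  by have := ltn_ord v; lia.
by have := offset_lt t (v %% 5); have := ltn_ord j; lia.
Qed.

(** Once both rows and both residues are fixed, membership is linear in the blocks, [i], [j] and
    [k]; finitely many cases remain. *)
Lemma block_edge_adj k (x y : 'I_3 * 'I_k) (u v : 'I_(5 * k)) : 4 < k ->
  x != y -> u != v -> u \in block_edge x :&: block_edge y ->
  v \in block_edge x :&: block_edge y -> (v == ordS u) || (u == ordS v).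
Proof.
move=> k_gt4; case: x y => t i [t' j].
rewrite xpair_eqE negb_and !in_setI !block_edgeE //.
rewrite -(inj_eq (@ord_inj 3)) -(inj_eq (@ord_inj k)).
rewrite -!(inj_eq (@ord_inj (5 * k))) !val_ordS.
have := ltn_ord u; have := ltn_ord v; have := ltn_ord i; have := ltn_ord j.
have := divn_eq u 5; have := divn_eq v 5.
have := ltn_pmod u (isT : 0 < 5); have := ltn_pmod v (isT : 0 < 5).
move: (u %/ 5) (v %/ 5) (u %% 5) (v %% 5) => p q r s s_lt r_lt Ev Eu.
rewrite /offset; case: t t' => -[|[|[|//]]] ? [[|[|[|//]]] ?] /=.
all: case: r r_lt Eu => [|[|[|[|[|//]]]]] _ Eu.
all: case: s s_lt Ev => [|[|[|[|[|//]]]]] _ Ev /=.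
all: try lia.
(* What is left depends on whether a successor wraps around to vertex 0. *)
all: by case: (u.+1 =P 5 * k); case: (v.+1 =P 5 * k); lia.
Qed.

(** Modulo [k], the block grows by one when the residue passes from 4 to 0 and is otherwise
    constant. If the offsets of row [t] do the same, one [j] serves both [v] and [ordS v]. *)
Lemma block_edge_cover_one k (v : 'I_(5 * k)) t : 4 < k ->
  (if v %% 5 == 4 then offset t 0 == (offset t 4).+1
   else offset t (v %% 5).+1 == offset t (v %% 5)) ->
  exists j, [set v; ordS v] \subset block_edge (t, j).
Proof.
move=> k_gt4 step; have := ltn_ord v; set p := v %/ 5 => v_lt.
have p_lt : p < k by lia.
have o_lt := offset_lt t (v %% 5).
(* The witness is the block minus the offset, modulo [k]. *)
have [j /orP pj] : exists j : 'I_k,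
    (p == j + offset t (v %% 5)) || (p + k == j + offset t (v %% 5)).
  have [le_op|lt_po] := leqP (offset t (v %% 5)) p.
    have j_lt : p - offset t (v %% 5) < k by lia.
    by exists (Ordinal j_lt) => /=; lia.
  have j_lt : p + k - offset t (v %% 5) < k by lia.
  by exists (Ordinal j_lt) => /=; lia.
exists j; rewrite subUset !sub1set !block_edgeE // -/p; apply/andP; split.
  exact/orP.
have j_lt := ltn_ord j; rewrite val_ordS.
move: step; case: (v %% 5 =P 4) => [r4|r4] /eqP step; last first.
  have -> : v.+1 == 5 * k = false by lia.
  have -> : v.+1 %/ 5 = p by lia.
  by have -> : v.+1 %% 5 = (v %% 5).+1 by [lia]; rewrite step; apply/orP.
move: o_lt pj; rewrite r4 => o_lt; case: (v.+1 =P 5 * k) => [vk|vk] pj.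
  (* The last vertex is followed by vertex 0, whose block 0 stands for [k]. *)
  by rewrite div0n mod0n step; lia.
have -> : v.+1 %/ 5 = p.+1 by lia.
have -> : v.+1 %% 5 = 0 by lia.
by rewrite step; lia.
Qed.

Lemma block_edge_cover k (v : 'I_(5 * k)) : 4 < k ->
  exists x y, x != y /\ [set v; ordS v] \subset block_edge x :&: block_edge y.
Proof.
move=> k_gt4.
have [t [t' [tt' step step']]] : exists t t' : 'I_3, [/\ t != t',
    if v %% 5 == 4 then offset t 0 == (offset t 4).+1
    else offset t (v %% 5).+1 == offset t (v %% 5) &
    if v %% 5 == 4 then offset t' 0 == (offset t' 4).+1
    else offset t' (v %% 5).+1 == offset t' (v %% 5)].
  have := ltn_pmod v (isT : 0 < 5); pose T i := @inord 2 i.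
  (* For each residue, the two rows are those whose difference has this residue and the next one in
     a common level set. *)
  case: (v %% 5) => [|[|[|[|[|//]]]]] _;
    [exists (T 0), (T 2)|exists (T 0), (T 1)|exists (T 0), (T 2)
    |exists (T 0), (T 1)|exists (T 1), (T 2)];
    by rewrite /offset -(inj_eq (@ord_inj _)) !inordK.
have [j sub] := block_edge_cover_one k v t k_gt4 step.
have [j' sub'] := block_edge_cover_one k v t' k_gt4 step'.
exists (t, j), (t', j'); split; last by rewrite subsetI sub.
by rewrite xpair_eqE (negPf tt').
Qed.

(* Found by computer search. *)
Definition edges20 : seq (seq nat) :=
  [:: [:: 0; 1; 17; 18; 19]; [:: 12; 13; 14; 18; 19]; [:: 0; 7; 8; 9; 19];
      [:: 0; 1; 2; 3; 4]; [:: 1; 2; 14; 15; 16]; [:: 2; 3; 8; 9; 10];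
      [:: 6; 7; 13; 14; 15]; [:: 4; 5; 6; 7; 8]; [:: 5; 6; 16; 17; 18];
      [:: 3; 4; 5; 11; 12]; [:: 10; 11; 15; 16; 17]; [:: 9; 10; 11; 12; 13]].

Definition edge20 (x : 'I_12) : {set 'I_20} :=
  [set v : 'I_20 | (v : nat) \in nth [::] edges20 x].

(** Reduces claims about ordinals to computations with natural numbers. *)
Lemma all_iota_ord n (P : pred nat) : all P (iota 0 n) -> forall i : 'I_n, P i.
Proof. by move=> /allP all_P i; apply: all_P; rewrite mem_iota /=. Qed.

Lemma card_edge20 x : #|edge20 x| = 5.
Proof.
rewrite cardsE -sum1_card.
rewrite -(big_mkord (fun v => v \in nth [::] edges20 x) (fun=> 1)) sum1_count.
apply/eqP; move: x; apply: (@all_iota_ord 12 (fun x => count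
  (fun v => v \in nth [::] edges20 x) (iota 0 20) == 5)).
by vm_compute.
Qed.

Lemma edge20_adj x y (u v : 'I_20) : x != y -> u != v ->
  u \in edge20 x :&: edge20 y -> v \in edge20 x :&: edge20 y ->
  (v == ordS u) || (u == ordS v).
Proof.
rewrite -!(inj_eq (@ord_inj _)) !in_setI !inE /=.
(* A computable list form of the intersection of two hyperedges. *)
pose meet i j := [seq w <- nth [::] edges20 i | w \in nth [::] edges20 j].
have ok : all (fun i => all (fun j => (i != j) ==> all (fun u => all (fun v =>
    (u != v) ==> (v == u.+1 %% 20) || (u == v.+1 %% 20))
    (meet i j)) (meet i j)) (iota 0 12)) (iota 0 12) by vm_compute.
move=> xy uv ux vx.
have /implyP/(_ xy)/allP ok_xy := all_iota_ord _ _ (all_iota_ord _ _ ok x) y.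
have /ok_xy/allP ok_u : (u : nat) \in meet x y by rewrite mem_filter andbC.
have /ok_u/implyP/(_ uv) : (v : nat) \in meet x y by rewrite mem_filter andbC.
by [].
Qed.

Lemma edge20_cover (v : 'I_20) :
  exists x y, x != y /\ [set v; ordS v] \subset edge20 x :&: edge20 y.
Proof.
have ok : all (fun v => has (fun x => has (fun y => [&& x != y,
    v \in nth [::] edges20 x, v \in nth [::] edges20 y,
    v.+1 %% 20 \in nth [::] edges20 x & v.+1 %% 20 \in nth [::] edges20 y])
    (iota 0 12)) (iota 0 12)) (iota 0 20) by vm_compute.
have /hasP[x x_lt /hasP[y y_lt /and5P[xy vx vy wx wy]]] := all_iota_ord _ _ ok v.
rewrite !mem_iota /= in x_lt y_lt.
exists (Ordinal x_lt), (Ordinal y_lt).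
by rewrite -val_eqE subUset !sub1set !inE /= xy vx vy wx wy.
Qed.

Theorem theorem9 (n : nat) (hn : 20 <= n) (hn5 : n = 0 %[mod 5]) :
  exists H : hypergraph 'I_n,
    [/\ uniform 5 H, EI H = cycle_graph n & 5 * #|H| = 3 * n].
Proof.
have [k def_n] : exists k, n = 5 * k by exists (n %/ 5); lia.
subst n; have [k4|k_gt4] : k = 4 \/ 4 < k by lia.
  subst k; have [H [unif ei card_H]] := hypergraph_of_family 20 5 _ _ isT isT
    card_edge20 edge20_adj edge20_cover.
  by exists H; rewrite card_H card_ord.
have [||H [unif ei card_H]] := hypergraph_of_family _ _ _ _ _ _
  (@card_block_edge k) (fun x y u v => @block_edge_adj k x y u v k_gt4)
  (fun v => block_edge_cover k v k_gt4); try lia.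
by exists H; split=> //; rewrite card_H card_prod !card_ord; lia.
Qed.
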